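(* Let $a<b$ be positive integers and suppose there exists a nonnegative integer $c$ such that every odd integer $u\geqslant 2c+1$ is a term of $\mathcal{V}(a,b)$. Then $\mathcal{V}(a,b)=\mathcal{V}(1,2)$ or $\mathcal{V}(a,b)=\mathcal{V}(1,3)$.
   Context: For positive integers $a<b$, the sequence $\mathcal{V}(a,b)=(a_m)_{m\geqslant 1}$ is defined greedily by $a_1=a$, $a_2=b$, and, for $m\geqslant 2$, $a_{m+1}$ is the smallest integer larger than $a_m$ that can be written as $a_i+a_j$ with $i\leqslant j\leqslant m$ (the two earlier terms not necessarily distinct) in exactly one way (representations are unordered pairs). *)

(* Defs.v *)
From mathcomp Require Import all_boot.

Set Implicit Arguments.
Unset Strict Implicit.
Unset Printing Implicit Defensive.

(* Number of representations n = s_i + s_j with i <= j.  The lists used below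
   are strictly increasing, so index pairs are the same as pairs of terms. *)
Definition nreps (s : seq nat) (n : nat) : nat :=
  #|[set p : 'I_(size s) * 'I_(size s) |
      (p.1 <= p.2) && (nth 0 s p.1 + nth 0 s p.2 == n)]|.

(* Smallest n > last s with exactly one representation.  The search may stop at
   2 * last s, which always has exactly one (see Vseq_next). *)
Definition next_term (s : seq nat) : nat :=
  head 0 [seq n <- iota (last 0 s).+1 (last 0 s) | nreps s n == 1].

Fixpoint Vprefix (a b k : nat) : seq nat :=
  if k is k'.+1 then
    rcons (Vprefix a b k') (next_term (Vprefix a b k'))
  else [:: a; b].

(* 0-based: Vseq a b m is the term a_(m+1) of V(a,b). *)
Definition Vseq (a b m : nat) : nat := nth 0 (Vprefix a b m) m.

Lemma size_Vprefix a b k : size (Vprefix a b k) = k.+2.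
Proof. by elim: k => //= k IH; rewrite size_rcons IH. Qed.

Lemma nth_Vprefix a b k l i : i < k.+2 -> k <= l ->
  nth 0 (Vprefix a b l) i = nth 0 (Vprefix a b k) i.
Proof.
move=> ik /subnK <-; elim: (l - k) => //= d IH.
by rewrite nth_rcons size_Vprefix (leq_trans ik) ?ltnS ?leq_addl.
Qed.

Lemma Vprefix_mkseq a b k : Vprefix a b k = mkseq (Vseq a b) k.+2.
Proof.
apply: (@eq_from_nth _ 0); rewrite size_Vprefix ?size_mkseq // => i ik.
rewrite nth_mkseq // /Vseq; case: (leqP i k) => ilek.
  by rewrite (@nth_Vprefix _ _ i).
by rewrite -(@nth_Vprefix _ _ k i) // ltnW.
Qed.

Lemma next_termP s : 0 < last 0 s -> sorted ltn s ->
  [/\ last 0 s < next_term s, nreps s (next_term s) = 1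
    & forall n, last 0 s < n < next_term s -> nreps s n != 1].
Proof.
move=> l_gt0 s_sorted; set l := last 0 s in l_gt0 *.
have s_gt0 : 0 < size s by case: (s) @l l_gt0.
have lE : l = nth 0 s (size s).-1 by rewrite nth_last.
pose o : 'I_(size s) := Ordinal (etrans (ltn_predL _) s_gt0).
have lt_l (i : 'I_(size s)) : i != o -> nth 0 s i < l.
  move=> io; rewrite lE; apply: (sorted_ltn_nth ltn_trans) => //.
  - by rewrite inE ltn_ord.
  - by rewrite inE (ltn_ord o).
  - have : i <= o by rewrite /= -ltnS prednK.
    by rewrite leq_eqVlt => /orP[/eqP/val_inj/eqP|//]; rewrite (negPf io).
have le_l (i : 'I_(size s)) : nth 0 s i <= l.
  by have [->|/lt_l/ltnW//] := eqVneq i o; rewrite lE.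
have ll : nreps s (l + l) = 1.
  rewrite /nreps (_ : [set _ | _] = [set (o, o)]) ?cards1 //.
  apply/setP => -[i j]; rewrite !inE /= xpair_eqE.
  have [->|/lt_l ilt] := eqVneq i o.
    have [->|/lt_l jlt] := eqVneq j o; first by rewrite leqnn -lE eqxx.
    by apply/negbTE; rewrite negb_and neq_ltn -lE ltn_add2l jlt orbT.
  apply/negbTE; rewrite negb_and neq_ltn.
  by rewrite -addSn leq_add ?orbT // le_l.
rewrite /next_term -/l; set P := fun n => nreps s n == 1.
have hasP : has P (iota l.+1 l).
  apply/hasP; exists (l + l); last by rewrite /P ll.
  by rewrite mem_iota -{1}[l.+1]addn1 leq_add2l l_gt0 addSn ltnS leqnn.
have ltf : find P (iota l.+1 l) < l by move: hasP; rewrite has_find size_iota.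
have -> : head 0 (filter P (iota l.+1 l)) = l.+1 + find P (iota l.+1 l).
  rewrite -(nth_iota 0 _ ltf).
  by elim: (iota _ _) hasP => //= x r IH; case: ifP.
split; first by rewrite addSn ltnS leq_addr.
  by have:= nth_find 0 hasP; rewrite nth_iota // => /eqP.
move=> n /andP[ln]; rewrite -{1}(subnKC ln) ltn_add2l => lf.
by have:= before_find 0 lf; rewrite nth_iota ?subnKC ?(ltn_trans lf) // => /negbT.
Qed.

Lemma Vprefix_sorted a b k : 0 < a < b ->
  sorted ltn (Vprefix a b k) && (0 < last 0 (Vprefix a b k)).
Proof.
move=> /andP[a0 ab]; elim: k => [|k /andP[s_sorted l_gt0]] /=.
  by rewrite ab (ltn_trans a0 ab).
have [lt_next _ _] := next_termP l_gt0 s_sorted.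
rewrite last_rcons (leq_ltn_trans _ lt_next) // andbT.
case: (Vprefix a b k) s_sorted lt_next => //= x r xr lt_next.
by rewrite rcons_path xr; exact: lt_next.
Qed.

(* The defining property of V(a,b). *)
Lemma Vseq_next a b m : 0 < a < b -> 0 < m ->
  [/\ Vseq a b m < Vseq a b m.+1,
      nreps (mkseq (Vseq a b) m.+1) (Vseq a b m.+1) = 1
    & forall n, Vseq a b m < n < Vseq a b m.+1 ->
        nreps (mkseq (Vseq a b) m.+1) n != 1].
Proof.
case: m => // k ab _; have /andP[srt l0] := Vprefix_sorted k ab.
have lE : last 0 (Vprefix a b k) = Vseq a b k.+1.
  by rewrite -nth_last size_Vprefix /Vseq (@nth_Vprefix _ _ k).
have nE : next_term (Vprefix a b k) = Vseq a b k.+2.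
  rewrite /Vseq (@nth_Vprefix _ _ k.+1) //= nth_rcons size_Vprefix ltnn.
  by rewrite eqxx.
by have := next_termP l0 srt; rewrite lE nE Vprefix_mkseq.
Qed.

(* Main.v *)
Require Import Defs.
From mathcomp Require Import all_boot.
From mathcomp Require Import zify.

(** Every large odd term is an even term plus an odd term, and conversely for
    each even term [e] and each large odd [u] the sum [e + (u - e)] represents
    [u]; since [u] has exactly one representation, there is exactly one even
    term [e].  Hence an odd [n > b] is a term only if [n - e] is, so every odd term
    is congruent modulo [e] to an odd element of [{a, b}].  All odd residues
    modulo [e] occur, which leaves [e = 2] when only one of [a], [b] is odd, and
    [a + b = e = 4] when both are, because [a + b] is always a term.  Finally
    [a = e = 2] is impossible, because [2b] would be a second even term. *)

(** Strict monotonicity makes [nth] an order-preserving bijection from indices to terms, so index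
    pairs can be traded for pairs of values. *)
Lemma nreps1P (s : seq nat) (n : nat) : sorted ltn s ->
  nreps s n = 1 <->
  exists! p : nat * nat, [/\ p.1 \in s, p.2 \in s, p.1 <= p.2 & p.1 + p.2 = n].
Proof.
move=> s_sorted; have nth_mono := leq_mono_in (sorted_ltn_nth ltn_trans 0 s_sorted).
have s_uniq : uniq s by move: s_sorted; rewrite ltn_sorted_uniq_leq => /andP[].
split=> [/eqP/cards1P[[i j] /setP ijP] | [[x y] /= [[xs ys xy xyn] uniq_xy]]].
  have := ijP (i, j); rewrite !inE eqxx /= => /andP[ij /eqP ijn].
  exists (nth 0 s i, nth 0 s j); split=> /=.
    by split; rewrite ?mem_nth // nth_mono // inE.
  move=> [x y] /= [/(nthP 0)[k ks <-] /(nthP 0)[l ls <-]].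
  rewrite nth_mono ?inE // => kl kln.
  have := ijP (Ordinal ks, Ordinal ls).
  by rewrite !inE /= kl kln eqxx => /esym/eqP[<- <-].
have [xlt ylt] : index x s < size s /\ index y s < size s by rewrite !index_mem.
apply/eqP/cards1P; exists (Ordinal xlt, Ordinal ylt).
apply/setP=> -[i j]; rewrite !inE xpair_eqE /=; apply/andP/andP=> [[ij /eqP ijn]|].
  have [] : (x, y) = (nth 0 s i, nth 0 s j).
    by apply: uniq_xy; split; rewrite ?mem_nth //= nth_mono // inE.
  by move=> xE yE; split; apply/eqP/val_inj; rewrite /= ?xE ?yE index_uniq.
move=> [/eqP-> /eqP->] /=.
by rewrite -nth_mono ?inE // !nth_index // xyn.
Qed.

Definition Vterm (a b n : nat) : Prop := exists m, Vseq a b m = n.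

Definition Vrep (a b n : nat) (p : nat * nat) : Prop :=
  [/\ Vterm a b p.1, Vterm a b p.2, p.1 <= p.2 & p.1 + p.2 = n].

Section Terms.

Variables a b : nat.
Hypotheses (a_gt0 : 0 < a) (ab : a < b).

Lemma Vseq_mono : {mono Vseq a b : i j / i < j}.
Proof.
apply: leqW_mono; apply: leq_mono; apply: homo_ltn; first exact: ltn_trans.
by case=> [//|m]; have [] := @Vseq_next a b m.+1; rewrite ?a_gt0.
Qed.

Lemma Vterm_a : Vterm a b a. Proof. by exists 0. Qed.

Lemma Vterm_b : Vterm a b b. Proof. by exists 1. Qed.

Lemma Vterm_le_b n : Vterm a b n -> n <= b -> n = a \/ n = b.
Proof.
case=> [[|[|m]]] <-; [by left | by right |].
by rewrite leqNgt (_ : b = Vseq a b 1) // Vseq_mono.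
Qed.

Lemma Vterm_ge_a n : Vterm a b n -> a <= n.
Proof. by case=> m <-; rewrite (_ : a = Vseq a b 0) // leqNgt Vseq_mono. Qed.

(** Terms are positive, so both summands of [n] lie below [n]: its representations in the whole
    sequence are those in the prefix of terms below [n], to which the greedy rule applies. *)
Lemma VtermP n : b < n -> Vterm a b n <-> exists! p, Vrep a b n p.
Proof.
move=> bn.
have Vm k : k <= Vseq a b k.
  by elim: k => // k IH; rewrite (leq_ltn_trans IH) ?Vseq_mono.
(* [m] indexes the last term below [n]; it exists since [b < n], and [k <= Vseq a b k] bounds the
   candidates. *)
have [m /andP[m_gt0 mn] m_max] :
    {m | (0 < m) && (Vseq a b m < n) & forall k, (0 < k) && (Vseq a b k < n) -> k <= m}.
  have exP : exists m, (0 < m) && (Vseq a b m < n) by exists 1.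
  have ubP k : (0 < k) && (Vseq a b k < n) -> k <= n.
    by move=> /andP[_ /ltnW]; apply: leq_trans.
  by case: (ex_maxnP exP ubP) => m Pm maxm; exists m.
have nm : n <= Vseq a b m.+1.
  by rewrite leqNgt; apply/negP=> lt_n; have := m_max m.+1 lt_n; rewrite ltnn.
have aab : 0 < a < b by rewrite a_gt0.
have [_ rep1 rep_n1] := Vseq_next aab m_gt0.
have srt : sorted ltn (mkseq (Vseq a b) m.+1).
  by rewrite sorted_map (eq_sorted Vseq_mono) iota_ltn_sorted.
have mem_lt x : Vterm a b x -> x < n -> x \in mkseq (Vseq a b) m.+1.
  move=> [k <-] kn; apply: map_f; rewrite mem_iota /= add0n.
  by rewrite -Vseq_mono (leq_trans kn).
have memT x : x \in mkseq (Vseq a b) m.+1 -> Vterm a b x.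
  by case/mapP=> k _ ->; exists k.
have repE p : Vrep a b n p <->
    [/\ p.1 \in mkseq (Vseq a b) m.+1, p.2 \in mkseq (Vseq a b) m.+1,
        p.1 <= p.2 & p.1 + p.2 = n].
  split=> [[T1 T2 le12 sum]|[/memT T1 /memT T2 le12 sum]]; last by split.
  have := Vterm_ge_a _ T1; have := Vterm_ge_a _ T2 => ? ?.
  by split=> //; apply: mem_lt => //; lia.
have uniqE : (exists! p, Vrep a b n p) <-> nreps (mkseq (Vseq a b) m.+1) n = 1.
  rewrite nreps1P //; split=> -[p [/repE rp up]]; exists p; split=> //.
    by move=> q /repE/up.
  by move=> q /repE/up.
rewrite uniqE; split=> [[k kn]|n1].
  suff -> : n = Vseq a b m.+1 by [].
  apply/eqP; rewrite eqn_leq nm -kn leqNgt Vseq_mono; apply/negP.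
  by rewrite ltnNge => /negP[]; rewrite -Vseq_mono kn.
exists m.+1; apply/eqP; rewrite eqn_leq nm andbT leqNgt; apply/negP=> nlt.
by have := rep_n1 n; rewrite mn nlt n1 => /(_ isT).
Qed.

Variable c : nat.
Hypothesis odd_terms : forall u, odd u -> 2 * c + 1 <= u -> Vterm a b u.

Lemma unique_even_term : exists e,
  [/\ Vterm a b e, ~~ odd e & forall x, Vterm a b x -> ~~ odd x -> x = e].
Proof.
have [[x y] [[/= Tx Ty xy xyu] _]] :
    exists! p, Vrep a b (2 * (c + b) + 1) p.
  by apply/VtermP; [lia | apply: odd_terms; lia].
have [e [Te ev_e]] : exists e, Vterm a b e /\ ~~ odd e.
  have [ox|ex] := boolP (odd x); last by exists x.
  by exists y; split=> //; lia.
exists e; split=> // f Tf ev_f.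
(* Large enough that [u - e] and [u - f] are odd terms exceeding [e] and [f], so both pairs are
   correctly ordered. *)
pose u := 2 * (e + f + c + b) + 1.
have [p [_ up]] : exists! p, Vrep a b u p.
  by apply/VtermP; rewrite /u; [lia | apply: odd_terms; lia].
have rep z : z = e \/ z = f -> Vrep a b u (z, u - z).
  move=> zef; have [Tz ev_z] : Vterm a b z /\ ~~ odd z by case: zef => ->.
  by split=> //=; rewrite /u; try (apply: odd_terms); lia.
by have [] := etrans (esym (up _ (rep f (or_intror erefl))))
                     (up _ (rep e (or_introl erefl))).
Qed.

Variable e : nat.
Hypotheses (Te : Vterm a b e) (ev_e : ~~ odd e).
Hypothesis e_uniq : forall x, Vterm a b x -> ~~ odd x -> x = e.

(** Exactly one summand of an odd number is even, and that one must be [e]. *)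
Lemma odd_term_descent n : odd n -> b < n -> Vterm a b n ->
  e < n /\ Vterm a b (n - e).
Proof.
move=> on bn /VtermP-/(_ bn)[[x y] [[/= Tx Ty _ xyn] _]].
have := Vterm_ge_a _ Tx; have := Vterm_ge_a _ Ty => ? ?.
have [ox|/(e_uniq _ Tx) xe] := boolP (odd x).
  have ye : y = e by apply: e_uniq => //; lia.
  have -> : n - e = x by lia.
  by split=> //; lia.
have -> : n - e = y by lia.
by split=> //; lia.
Qed.

(** Subtract [e] repeatedly: since [e >= a > 0], the descent reaches a term at most [b], which is
    [a] or [b]. *)
Lemma odd_term_mod n : odd n -> Vterm a b n ->
  (odd a /\ n = a %[mod e]) \/ (odd b /\ n = b %[mod e]).
Proof.
elim/ltn_ind: n => n IH on Tn.
case: (leqP n b) => [/(Vterm_le_b _ Tn)[<-|<-]|bn]; [by left | by right |].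
have [en Tne] := odd_term_descent _ on bn Tn.
have := Vterm_ge_a _ Te => ae.
rewrite -(subnK (ltnW en)) modnDr; apply: IH => //; lia.
Qed.

Lemma cong_le d u : 0 < d -> u + d = u %[mod e] -> e <= d.
Proof.
by move=> d0 /eqP; rewrite eqn_mod_dvd ?leq_addr // addKn; apply: dvdn_leq.
Qed.

(** Both [u] and [u + 2] are congruent to the only odd initial term, so [e <= 2]; being even and
    positive, [e] is 2. *)
Lemma exactly_one_odd : odd a != odd b -> e = 2.
Proof.
move=> oab; pose u := 2 * c + 1.
have [ou ou2 cu2] : [/\ odd u, odd (u + 2) & 2 * c + 1 <= u + 2] by split; lia.
have /cong_le : u + 2 = u %[mod e].
  have [[oa ->]|[ob ->]] := odd_term_mod _ ou (odd_terms _ ou (leqnn _));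
    have [[oa' ->]|[ob' ->]] := odd_term_mod _ ou2 (odd_terms _ ou2 cu2) => //.
    by rewrite oa ob' in oab.
  by rewrite oa' ob in oab.
by move=> /(_ isT); have := Vterm_ge_a _ Te; lia.
Qed.

Lemma both_odd : odd a -> odd b -> a + b = 4.
Proof.
move=> oa ob; pose u := 2 * c + 1.
(* In any representation [x >= a] forces [y <= b], so [y] is [a] or [b], and [y = a] would make
   [x = b] the larger summand. *)
have Tab : Vterm a b (a + b).
  apply/VtermP; first lia.
  exists (a, b); split=> [|[x y] [/= Tx Ty xy xyab]].
    by split=> //=; [exact: Vterm_a | exact: Vterm_b | exact: ltnW].
  have := Vterm_ge_a _ Tx => ax.
  have /(Vterm_le_b _ Ty)[ya|yb] : y <= b by lia.
    by lia.
  by congr (_, _); lia.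
have eab : a + b = e by apply: e_uniq => //; lia.
have modP v : odd v -> 2 * c + 1 <= v -> v = a %[mod e] \/ v = b %[mod e].
  by move=> ov cv; case: (odd_term_mod _ ov (odd_terms _ ov cv)) => -[_]; [left|right].
(* Distinct odd [a] and [b] already give [a + b >= 4]. *)
suff : e <= 4 by lia.
have [le0 le2 le4] : [/\ 2 * c + 1 <= u, 2 * c + 1 <= u + 2 & 2 * c + 1 <= u + 4].
  by split; lia.
have [o0 o2 o4] : [/\ odd u, odd (u + 2) & odd (u + 4)] by split; lia.
have u24 : u + 4 = u + 2 + 2 by rewrite -addnA.
have := modP _ o0 le0; have := modP _ o2 le2; have := modP _ o4 le4.
(* Two of [u], [u + 2], [u + 4] agree modulo [e], by pigeonhole on [a], [b]. *)
move=> [h4|h4] [h2|h2] [h0|h0];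
  first [ by apply: (@cong_le 4 u); rewrite // h4 h0
        | by apply: (@leq_trans 2) => //; apply: (@cong_le 2 u); rewrite // h2 h0
        | by apply: (@leq_trans 2) => //; apply: (@cong_le 2 (u + 2));
             rewrite // -u24 h4 h2 ].
Qed.

End Terms.

Theorem theorem2p2 (a b : nat) (ha : 0 < a) (hab : a < b)
  (h : exists c : nat, forall u : nat,
         odd u -> 2 * c + 1 <= u -> exists m : nat, Vseq a b m = u) :
  Vseq a b =1 Vseq 1 2 \/ Vseq a b =1 Vseq 1 3.
Proof.
have [c odd_terms] := h.
have [e [Te ev_e e_uniq]] := unique_even_term a b ha hab c odd_terms.
have mixed := exactly_one_odd a b ha hab c odd_terms e Te ev_e e_uniq.
have b_even : ~~ odd b -> b = e by apply: e_uniq; exact: Vterm_b.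
have a_even : ~~ odd a -> a = e by apply: e_uniq; exact: Vterm_a.
have [ob|/[dup] ev_b /b_even be] := boolP (odd b); last first.
  (* Two even initial terms would both equal [e], against [a < b]. *)
  have oa : odd a by apply/negPn/negP=> /a_even; lia.
  have e2 : e = 2 by apply: mixed; rewrite oa (negPf ev_b).
  by left; have -> : a = 1 by [lia]; rewrite be e2.
have [oa|/[dup] ev_a /a_even ae] := boolP (odd a).
  have ab4 := both_odd a b ha hab c odd_terms e Te ev_e e_uniq oa ob.
  by right; have [-> ->] : a = 1 /\ b = 3 by lia.
have e2 : e = 2 by apply: mixed; rewrite ob (negPf ev_a).
have odd_ge_b x : Vterm a b x -> odd x -> b <= x.
  move=> Tx ox; rewrite leqNgt; apply/negP=> xb.
  by have [] := Vterm_le_b a b ha hab x Tx (ltnW xb); lia.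
(* A representation of [b + b] by odd terms needs both at least [b], as [a] is even; one by even
   terms would be [e + e], forcing [b = e]. *)
have Tbb : Vterm a b (b + b).
  apply/VtermP => //; first lia.
  exists (b, b); split=> [|[x y] /= [/= Tx Ty xy xyb]].
    by split=> //=; exact: Vterm_b.
  have [ox|ev_x] := boolP (odd x).
    have oy : odd y by lia.
    have := odd_ge_b _ Tx ox; have := odd_ge_b _ Ty oy => ? ?.
    by congr (_, _); lia.
  have := e_uniq _ Tx ev_x; have := e_uniq y Ty ltac:(lia); lia.
by have := e_uniq _ Tbb ltac:(lia); lia.
Qed.
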